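(* Let $p$ be a nonzero real number, let $x,a$ be complex numbers, and let $n$ be any nonnegative integer. Then $$(x,a)^{-1_p}=\left(x\,e^{\frac{i(2n+1)\pi}{p}},\;a\,e^{\frac{i(2n+1)\pi}{p}}\right)$$ is a Hölder-Minkowski inverse of $(x,a)$, that is, $$H_p\left((x,a),\left(x\,e^{\frac{i(2n+1)\pi}{p}},\,a\,e^{\frac{i(2n+1)\pi}{p}}\right)\right)=(0,0).$$
   Context: For $p\in\mathbb{R}\setminus\{0\}$ the Hölder-Minkowski operation on pairs of complex numbers is $H_p((x,a),(y,b))=\big((x^p+y^p)^{1/p},\,(a^p+b^p)^{1/p}\big)$. A Hölder-Minkowski inverse of an element $(x,a)$ is an element $(y,b)$ with $H_p((x,a),(y,b))=(0,0)$, where $(0,0)$ is the identity element. Convention on powers: complex numbers are kept in a general polar form $re^{i\theta}$, with the real argument $\theta$ not reduced modulo $2\pi$ (e.g. $-1=e^{i(2n+1)\pi}$), and powers are taken as $(re^{i\theta})^p=r^pe^{ip\theta}$. Hence $(z^p)^{1/p}=z$ and $(z\,e^{i\varphi/p})^p=z^p e^{i\varphi}$ always hold. For $z=0$, $0^p=0^{1/p}=0$. *)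

(* Defs.v *)
From HB Require Import structures.
From mathcomp Require Import all_boot all_order all_algebra.
From mathcomp Require Import all_classical all_reals all_analysis.
From mathcomp Require Import complex.

Set Implicit Arguments.
Unset Strict Implicit.
Unset Printing Implicit Defensive.

Import Order.TTheory GRing.Theory Num.Theory.
Local Open Scope ring_scope.

(* A complex number kept in polar form: either 0, or r e^{i theta} with r > 0
   and theta a real number that is not reduced modulo 2 pi.  Leibniz equality
   thus distinguishes, e.g., e^{i pi} and e^{3 i pi}, while 0 has a single
   polar form. *)
Inductive polar (R : realType) : Type :=
| PZero
| Polar of {posnum R} & R.

Arguments PZero {R}.

(* The complex number of which z is a polar form. *)
Definition value (R : realType) (z : polar R) : R[i] :=
  match z with
  | PZero => 0
  | Polar r t => Complex (r%:num * cos t) (r%:num * sin t)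
  end.

Definition pexpi (R : realType) (t : R) : polar R := Polar 1%:pos t.

Definition pmul (R : realType) (z w : polar R) : polar R :=
  match z, w with
  | Polar r t, Polar s u => Polar (r%:num * s%:num)%:pos (t + u)
  | _, _ => PZero
  end.

(* 0^p = 0 also for p < 0. *)
Definition ppow (R : realType) (z : polar R) (p : R) : polar R :=
  match z with
  | PZero => PZero
  | Polar r t => Polar (r%:num `^ p)%:pos (p * t)
  end.

(* The sum of two complex numbers, again kept in polar form.  When neither
   summand is 0 the argument of the sum is only determined modulo 2 pi, so any
   choice of it is allowed; adding 0 does not change the polar form. *)
Record polar_addition (R : realType) := PolarAddition {
  padd :> polar R -> polar R -> polar R;
  value_padd : forall z w, value (padd z w) = value z + value w;
  padd0 : forall z, padd z PZero = z;
  p0add : forall z, padd PZero z = z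
}.

Definition holder_minkowski (R : realType) (add : polar_addition R) (p : R)
    (u v : polar R * polar R) : polar R * polar R :=
  (ppow (add (ppow u.1 p) (ppow v.1 p)) p^-1,
   ppow (add (ppow u.2 p) (ppow v.2 p)) p^-1).

Definition is_hm_inverse (R : realType) (add : polar_addition R) (p : R)
    (u v : polar R * polar R) : Prop :=
  holder_minkowski add p u v = (PZero, PZero).

Lemma ppowK (R : realType) (p : R) (z : polar R) :
  p != 0 -> ppow (ppow z p) p^-1 = z.
Proof.
move=> p0; case: z => //= r t; congr Polar; last by rewrite mulKf.
by apply/val_inj; rewrite /= -powRrM mulfV// powRr1.
Qed.

Lemma ppow_pmul_pexpi (R : realType) (p t : R) (z : polar R) :
  p != 0 -> ppow (pmul z (pexpi (t / p))) p = pmul (ppow z p) (pexpi t).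
Proof.
move=> p0; case: z => //= r s; congr Polar.
  by apply/val_inj; rewrite /= !mulr1.
by rewrite mulrDr [p * (t / p)]mulrC divfK.
Qed.

Lemma holder_minkowski0 (R : realType) (add : polar_addition R) (p : R)
    (u : polar R * polar R) :
  p != 0 -> holder_minkowski add p u (PZero, PZero) = u.
Proof.
by move=> p0; case: u => x a; rewrite /holder_minkowski /= !padd0 !ppowK.
Qed.

Lemma value_surj (R : realType) (z : R[i]) : exists w, value w = z.
Proof.
have [->|z0] := eqVneq z 0; first by exists PZero.
case: z z0 => a b; rewrite eq_complex /= => ab0.
have s0 : 0 < a ^+ 2 + b ^+ 2.
  rewrite lt_neqAle addr_ge0 ?sqr_ge0// andbT eq_sym.
  by rewrite paddr_eq0 ?sqr_ge0// !sqrf_eq0.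
pose r := Num.sqrt (a ^+ 2 + b ^+ 2).
have r0 : 0 < r by rewrite sqrtr_gt0.
have rE : r ^+ 2 = a ^+ 2 + b ^+ 2 by rewrite sqr_sqrtr// ltW.
have ar : -1 <= a / r <= 1.
  rewrite -ler_norml normf_div (gtr0_norm r0) ler_pdivrMr// mul1r.
  rewrite -(@ler_pXn2r _ 2) ?nnegrE ?normr_ge0 ?(ltW r0)//.
  by rewrite real_normK ?num_real// rE lerDl sqr_ge0.
have rs : r * sin (acos (a / r)) = `|b|.
  rewrite sin_acos// -{1}[r]gtr0_norm// -sqrtr_sqr -sqrtrM ?sqr_ge0//.
  rewrite mulrBr mulr1 -exprMn [r * _]mulrC divfK ?gt_eqF// rE addrAC subrr.
  by rewrite add0r sqrtr_sqr.
have rc : r * cos (acos (a / r)) = a.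
  by rewrite acosK// mulrC divfK ?gt_eqF.
have [b0|b0] := leP 0 b.
  exists (Polar (PosNum r0) (acos (a / r))) => /=.
  by rewrite rc rs ger0_norm.
exists (Polar (PosNum r0) (- acos (a / r))) => /=.
by rewrite cosN sinN rc mulrN rs ltr0_norm// opprK.
Qed.

Lemma polar_addition_exists (R : realType) : inhabited (polar_addition R).
Proof.
have [f fE] := choice (@value_surj R).
pose add z w := match z, w with
  | PZero, _ => w
  | _, PZero => z
  | _, _ => f (value z + value w)
  end.
apply: inhabits; apply: (@PolarAddition R add).
- by case=> [|r t] [|s u]; rewrite /add ?fE//= ?add0r ?addr0.
- by case.
- by case.
Qed.

(* Main.v *)
Require Import Defs.
From mathcomp Require Import all_boot all_order all_algebra.
From mathcomp Require Import all_classical all_reals all_analysis.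
From mathcomp Require Import complex.

Import Order.TTheory GRing.Theory Num.Theory.
Local Open Scope ring_scope.

(** Multiplying [z] by [e^{i(2n+1)pi/p}] multiplies its [p]-th power by
    [e^{i(2n+1)pi}] exactly, because arguments are not reduced modulo [2 pi]
    ([ppow_pmul_pexpi]).  This factor has value [-1], so the two summands in
    each coordinate have opposite values ([value_pmul_oddpi]) and their sum has
    value [0].  Sums are in general only known through their value, but [0] has
    a single polar form ([value_eq0]): the sum is [PZero], and so is its
    [1/p]-th power. *)

Lemma cos_sin_oddpi (R : realType) (t : R) (n : nat) :
  cos (t + (2 * n%:R + 1) * pi) = - cos t /\
  sin (t + (2 * n%:R + 1) * pi) = - sin t.
Proof.
have -> : t + (2 * n%:R + 1) * pi = t + pi + pi *+ 2 *+ n.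
  rewrite mulrDl mul1r addrCA addrA -addrA addrC; congr (_ + _).
  by rewrite -mulrA mulr_natl mulr_natl mulrnAC.
by rewrite !(periodicn (@cosD2pi R)) !(periodicn (@sinD2pi R)) cosDpi sinDpi.
Qed.

Lemma value_pmul_oddpi (R : realType) (z : polar R) (n : nat) :
  value (pmul z (pexpi ((2 * n%:R + 1) * pi))) = - value z.
Proof.
case: z => [|r t] /=; first by rewrite oppr0.
have [-> ->] := cos_sin_oddpi R t n.
by rewrite mulr1 !mulrN.
Qed.

(** The modulus of a [Polar] form is positive, and [cos t] and [sin t] are never
    both zero. *)
Lemma value_eq0 (R : realType) (z : polar R) : value z = 0 -> z = PZero.
Proof.
case: z => //= r t [/eqP rc /eqP rs].
have r0 : (r%:num == 0) = false by apply: gt_eqF.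
move: rc rs; rewrite !mulf_eq0 r0 /= => /eqP c0 /eqP s0.
have := cos2Dsin2 t; rewrite c0 s0 expr0n addr0 => /eqP.
by rewrite eq_sym oner_eq0.
Qed.

Lemma padd_ppow_oddpi (R : realType) (add : polar_addition R) (p : R)
    (z : polar R) (n : nat) :
  p != 0 ->
  add (ppow z p) (ppow (pmul z (pexpi ((2 * n%:R + 1) * pi / p))) p) = PZero.
Proof.
move=> p0; apply: value_eq0.
by rewrite value_padd ppow_pmul_pexpi// value_pmul_oddpi subrr.
Qed.

Theorem theorem10p2 (R : realType) (add : polar_addition R) (p : R)
    (x a : polar R) (n : nat) :
  p != 0 ->
  is_hm_inverse add p (x, a)
    (pmul x (pexpi ((2 * n%:R + 1) * pi / p)),
     pmul a (pexpi ((2 * n%:R + 1) * pi / p))).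
Proof.
by move=> p0; rewrite /is_hm_inverse /holder_minkowski !padd_ppow_oddpi.
Qed.
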